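(* Let $\mathbb{Q}_0^{i}$ be the initial algebra $I(\Sigma_{imd}, E)$ among all algebras over the signature $\Sigma_{imd}=\{0,1,+,\cdot,-,{}^{-1}\}$ that satisfy the set $E$ of equations consisting of the axioms of inversive meadows together with the equation $$(1+x^2+y^2)\cdot(1+x^2+y^2)^{-1}=1 .$$ Then $\mathbb{Q}_0^{i}$ is (up to isomorphism) the zero-totalized field of rational numbers, i.e. the $\Sigma_{imd}$-algebra that differs from the field of rational numbers (with its usual multiplicative inverse on nonzero elements) only in that $0^{-1}=0$.
   Context: The signature $\Sigma_{imd}$ has constants $0,1$, binary operators $+,\cdot$, a unary prefix operator $-$ (additive inverse) and a unary postfix operator ${}^{-1}$ (multiplicative inverse). The axioms of inversive meadows are the following equations (universally quantified): $(x+y)+z=x+(y+z)$, $x+y=y+x$, $x+0=x$, $x+(-x)=0$, $(x\cdot y)\cdot z=x\cdot(y\cdot z)$, $x\cdot y=y\cdot x$, $x\cdot 1=x$, $x\cdot(y+z)=x\cdot y+x\cdot z$, $(x^{-1})^{-1}=x$, $x\cdot(x\cdot x^{-1})=x$. Here $p^2$ abbreviates $p\cdot p$. $I(\Sigma,E)$ denotes the initial algebra in the class of all $\Sigma$-algebras satisfying $E$, equivalently the quotient of the closed $\Sigma$-terms by provable equality from $E$ in equational logic; it is determined up to isomorphism. *)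

(* Defs.v *)
(* MathComp, with the classical layer of MathComp-Analysis (boolp) used to turn
   provable equality into a boolean relation. *)
From HB Require Import structures.
From mathcomp Require Import all_boot all_order all_algebra.
From mathcomp Require Import boolp.

Set Implicit Arguments.
Unset Strict Implicit.
Unset Printing Implicit Defensive.

Import GRing.Theory.

Inductive term (V : Type) : Type :=
| Var of V
| Zero
| One
| Add of term V & term V
| Mul of term V & term V
| Opp of term V
| Inv of term V.

Arguments Zero {V}.
Arguments One {V}.

Declare Scope imd_scope.
Delimit Scope imd_scope with imd.
Bind Scope imd_scope with term.
Notation "0" := Zero : imd_scope.
Notation "1" := One : imd_scope.
Notation "s + t" := (Add s t) : imd_scope.
Notation "s * t" := (Mul s t) : imd_scope.
Notation "- t" := (Opp t) : imd_scope.
Notation "t ^-1" := (Inv t) : imd_scope.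

Fixpoint subst (V W : Type) (sigma : V -> term W) (t : term V) : term W :=
  match t with
  | Var v => sigma v
  | Zero => Zero
  | One => One
  | Add s t => Add (subst sigma s) (subst sigma t)
  | Mul s t => Mul (subst sigma s) (subst sigma t)
  | Opp t => Opp (subst sigma t)
  | Inv t => Inv (subst sigma t)
  end.

Record algebra : Type := Algebra {
  carrier :> Type;
  zero : carrier;
  one : carrier;
  add : carrier -> carrier -> carrier;
  mul : carrier -> carrier -> carrier;
  opp : carrier -> carrier;
  inv : carrier -> carrier }.

Fixpoint eval (V : Type) (A : algebra) (v : V -> A) (t : term V) : A :=
  match t with
  | Var x => v x
  | Zero => zero A
  | One => one A
  | Add s t => add (eval v s) (eval v t)
  | Mul s t => mul (eval v s) (eval v t)
  | Opp t => opp (eval v t)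
  | Inv t => inv (eval v t)
  end.

(* [E l r] reads "the equation l = r, universally quantified over its
   variables, belongs to E". *)
Definition theory : Type := term nat -> term nat -> Prop.

Definition satisfies (A : algebra) (E : theory) : Prop :=
  forall l r, E l r -> forall v : nat -> A, eval v l = eval v r.

Record hom (A B : algebra) (f : A -> B) : Prop := Hom {
  hom_zero : f (zero A) = zero B;
  hom_one : f (one A) = one B;
  hom_add : forall x y, f (add x y) = add (f x) (f y);
  hom_mul : forall x y, f (mul x y) = mul (f x) (f y);
  hom_opp : forall x, f (opp x) = opp (f x);
  hom_inv : forall x, f (inv x) = inv (f x) }.

Definition isomorphic (A B : algebra) : Prop :=
  exists f : A -> B, hom f /\ bijective f.

Definition is_initial (E : theory) (A : algebra) : Prop :=
  satisfies A E /\
  forall B : algebra, satisfies B E ->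
    exists f : A -> B, hom f /\ forall g : A -> B, hom g -> g =1 f.

Inductive provable (E : theory) : term nat -> term nat -> Prop :=
| prov_ax l r : E l r -> provable E l r
| prov_subst sigma s t :
    provable E s t -> provable E (subst sigma s) (subst sigma t)
| prov_refl t : provable E t t
| prov_sym s t : provable E s t -> provable E t s
| prov_trans s t u : provable E s t -> provable E t u -> provable E s u
| prov_add s s' t t' :
    provable E s s' -> provable E t t' -> provable E (s + t)%imd (s' + t')%imd
| prov_mul s s' t t' :
    provable E s s' -> provable E t t' -> provable E (s * t)%imd (s' * t')%imd
| prov_opp t t' : provable E t t' -> provable E (- t)%imd (- t')%imd
| prov_inv t t' : provable E t t' -> provable E (t^-1)%imd (t'^-1)%imd.

Definition cterm : Type := term void.
HB.instance Definition _ := gen_eqMixin cterm.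
HB.instance Definition _ := gen_choiceMixin cterm.

Definition embed (t : cterm) : term nat := subst (of_void (term nat)) t.

Section InitialAlgebra.
Variable E : theory.

Definition ceq (s t : cterm) : bool := `[< provable E (embed s) (embed t) >].

Lemma ceq_equiv : equiv_class_of ceq.
Proof.
split=> [t|s t|t s u].
- exact/asboolP/prov_refl.
- by apply/asboolP/asboolP; apply: prov_sym.
- by move=> /asboolP st /asboolP tu; apply/asboolP; apply: prov_trans tu.
Qed.

Canonical ceq_equiv_rel : equiv_rel cterm := EquivRelPack ceq_equiv.

Local Open Scope quotient_scope.

Definition Init_carrier : Type := {eq_quot ceq_equiv_rel}.
Let cls (t : cterm) : Init_carrier := \pi_{eq_quot ceq_equiv_rel} t.
Let rep (x : Init_carrier) : cterm := repr (x : {eq_quot ceq_equiv_rel}).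

(* I(Sigma_imd, E): closed terms modulo provable equality from E. *)
Definition Init : algebra := {|
  carrier := Init_carrier;
  zero := cls Zero;
  one := cls One;
  add := fun x y => cls (Add (rep x) (rep y));
  mul := fun x y => cls (Mul (rep x) (rep y));
  opp := fun x => cls (Opp (rep x));
  inv := fun x => cls (Inv (rep x)) |}.

Let clsP s t : provable E (embed s) (embed t) <-> cls s = cls t.
Proof.
rewrite /cls; split=> [st|/eqmodP/asboolP//].
by apply/eqmodP/asboolP.
Qed.

Let rep_cls t : provable E (embed (rep (cls t))) (embed t).
Proof. by apply/clsP; rewrite /cls /rep reprK. Qed.

Let cls_rep x : cls (rep x) = x.
Proof. by rewrite /cls /rep reprK. Qed.

Lemma Init_add s t : add (cls s : Init) (cls t) = cls (Add s t).
Proof. by apply/clsP/prov_add; apply: rep_cls. Qed.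

Lemma Init_mul s t : mul (cls s : Init) (cls t) = cls (Mul s t).
Proof. by apply/clsP/prov_mul; apply: rep_cls. Qed.

Lemma Init_opp t : opp (cls t : Init) = cls (Opp t).
Proof. by apply/clsP/prov_opp; apply: rep_cls. Qed.

Lemma Init_inv t : inv (cls t : Init) = cls (Inv t).
Proof. by apply/clsP/prov_inv; apply: rep_cls. Qed.

Let eval_cls (V : Type) (v : V -> Init) (t : term V) :
  eval v t = cls (subst (fun x => rep (v x)) t).
Proof.
elim: t => [x|||s IHs t IHt|s IHs t IHt|t IH|t IH] //.
- by rewrite /= cls_rep.
- by rewrite [LHS](congr2 (@add Init) IHs IHt) Init_add.
- by rewrite [LHS](congr2 (@mul Init) IHs IHt) Init_mul.
- by rewrite [LHS](congr1 (@opp Init) IH) Init_opp.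
- by rewrite [LHS](congr1 (@inv Init) IH) Init_inv.
Qed.

Lemma Init_satisfies : satisfies Init E.
Proof.
move=> l r lr v; rewrite !eval_cls; apply/clsP.
have embedE t : embed (subst (fun x => rep (v x)) t)
             = subst (fun x => embed (rep (v x))) t.
  rewrite /embed; elim: t => //= [s -> t ->|s -> t ->|t ->|t ->] //.
by rewrite !embedE; apply/prov_subst/prov_ax.
Qed.

Lemma eval_subst (V W : Type) (A : algebra) (sigma : V -> term W)
    (v : W -> A) t :
  eval v (subst sigma t) = eval (fun x => eval v (sigma x)) t.
Proof. by elim: t => //= [s -> t ->|s -> t ->|t ->|t ->]. Qed.

Lemma soundness (A : algebra) : satisfies A E ->
  forall s t, provable E s t -> forall v : nat -> A, eval v s = eval v t.
Proof.
move=> AE s t; elim=> {s t} /= [l r /AE//|sigma s t _ IH v|//|s t _ IH v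
  |s t u _ IH1 _ IH2 v|s s' t t' _ IH1 _ IH2 v|s s' t t' _ IH1 _ IH2 v
  |t t' _ IH v|t t' _ IH v].
- by rewrite !eval_subst IH.
- by rewrite IH.
- by rewrite IH1 IH2.
- by rewrite IH1 IH2.
- by rewrite IH1 IH2.
- by rewrite IH.
- by rewrite IH.
Qed.

Theorem Init_initial : is_initial E Init.
Proof.
split=> [|B BE]; first exact: Init_satisfies.
pose ev : cterm -> B := eval (of_void B).
have evE s : eval (fun=> zero B) (embed s) = ev s.
  rewrite /ev /embed.
  by elim: s => [[]|||s IHs t IHt|s IHs t IHt|t IH|t IH] //=; congruence.
have ev_rep t : ev (rep (cls t)) = ev t.
  by rewrite -!evE; apply: soundness BE _ _ (rep_cls t) _.
exists (fun x => ev (rep x)); split.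
  by split=> *; rewrite /= ev_rep.
move=> g gh x; rewrite -[x in LHS]cls_rep; case: gh => g0 g1 gD gM gN gV.
elim: (rep x) => [[]|||s IHs t IHt|s IHs t IHt|t IH|t IH] //.
- by rewrite -Init_add gD IHs IHt.
- by rewrite -Init_mul gM IHs IHt.
- by rewrite -Init_opp gN IH.
- by rewrite -Init_inv gV IH.
Qed.

End InitialAlgebra.

Section Meadows.
Local Notation x := (Var 0%N).
Local Notation y := (Var 1%N).
Local Notation z := (Var 2%N).
Local Open Scope imd_scope.

Inductive inversive_meadow : theory :=
| imd_addA : inversive_meadow ((x + y) + z) (x + (y + z))
| imd_addC : inversive_meadow (x + y) (y + x)
| imd_add0 : inversive_meadow (x + 0) x
| imd_addN : inversive_meadow (x + (- x)) 0
| imd_mulA : inversive_meadow ((x * y) * z) (x * (y * z))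
| imd_mulC : inversive_meadow (x * y) (y * x)
| imd_mul1 : inversive_meadow (x * 1) x
| imd_mulD : inversive_meadow (x * (y + z)) (x * y + x * z)
| imd_invK : inversive_meadow ((x^-1)^-1) x
| imd_ril : inversive_meadow (x * (x * x^-1)) x.

Inductive meadow_sq2 : theory :=
| sq2_imd l r : inversive_meadow l r -> meadow_sq2 l r
| sq2_inv : meadow_sq2 ((1 + x * x + y * y) * (1 + x * x + y * y)^-1) 1.

End Meadows.

(* The inverse of [rat] is already zero-totalized: [invr0 : 0^-1 = 0]. *)
Definition Q0 : algebra := {|
  carrier := rat;
  zero := 0%R;
  one := 1%R;
  add := fun x y => (x + y)%R;
  mul := fun x y => (x * y)%R;
  opp := fun x => (- x)%R;
  inv := fun x => (x^-1)%R |}.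

(* Main.v *)
(* In a meadow, a factor of an invertible element is invertible.  By a pigeonhole
   count of squares in F_p, every prime p divides 1 + x^2 + y^2 for some naturals
   x and y, so the extra equation makes every prime, hence every positive numeral,
   invertible.  A model of the equations therefore receives a homomorphism from
   the zero-totalized rationals, n/d being sent to n * d^-1; applied to the initial
   algebra this inverts the canonical homomorphism into the rationals. *)
Require Import Defs.
From HB Require Import structures.
From mathcomp Require Import all_boot all_order all_algebra.
From mathcomp Require Import boolp ring.

Set Implicit Arguments.
Unset Strict Implicit.
Unset Printing Implicit Defensive.

Import Order.TTheory GRing.Theory Num.Theory.
Import Defs.
Local Open Scope ring_scope.

(** * Squares in finite fields *)

(** Squaring has fibres of at most two points, and the fibre over 0 is a single point, which makes
    the bound strict. *)
Lemma ltn_card_squares (F : finFieldType) :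
  (#|F| < 2 * #|[set x ^+ 2 | x in F]|)%N.
Proof.
pose S := [set x ^+ 2 | x in F].
have S0 : 0 \in S by apply/imsetP; exists 0; rewrite ?expr0n.
have fibre0 : #|[set x | x ^+ 2 == 0 :> F]| = 1%N.
  rewrite (_ : [set _ | _] = [set 0]) ?cards1 //.
  by apply/setP=> x; rewrite !inE expf_eq0.
have fibre a : a \in S -> (#|[set x | x ^+ 2 == a]| <= 2)%N.
  case/imsetP=> b _ ->; apply: leq_trans (_ : #|[set b; - b]| <= _)%N.
    by apply/subset_leq_card/subsetP=> x; rewrite !inE eqf_sqr.
  by rewrite cards2; case: (_ != _).
have -> : #|F| = (\sum_(a in S) #|[set x | x ^+ 2 == a]|)%N.
  rewrite -sum1_card (partition_big (fun x => x ^+ 2) (mem S)) /=.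
    by apply: eq_bigr => a _; apply: sum1dep_card.
  by move=> x _; apply/imsetP; exists x.
rewrite (big_setD1 0) //= fibre0 -/S [#|S|](cardsD1 0) S0 mulnDr muln1.
rewrite add1n !ltnS mulnC -sum_nat_const; apply: leq_sum => a /setD1P[_].
exact: fibre.
Qed.

Lemma sum2_squares_eqN1 (F : finFieldType) : exists x y : F, 1 + x ^+ 2 + y ^+ 2 = 0.
Proof.
pose S := [set x ^+ 2 | x in F]; pose T := [set - 1 - a | a in S].
have cT : #|T| = #|S| by apply: card_imset => a b /addrI/oppr_inj.
have /set0Pn[a] : S :&: T != set0.
  (* If [S] and [T] were disjoint, their union would have 2 * #|S| > #|F| elements. *)
  apply/eqP=> ST0; have := ltn_card_squares F.
  rewrite mul2n -addnn -{2}cT -cardsUI ST0 cards0 addn0 ltnNge.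
  by rewrite max_card.
case/setIP=> /imsetP[x _ ->] /imsetP[_ /imsetP[y _ ->] xy].
by exists x, y; rewrite xy; ring.
Qed.

Lemma prime_dvd_1_sum2_squares p : prime p ->
  exists x y, (p %| 1 + x * x + y * y)%N.
Proof.
move=> p_pr; have [x [y xy0]] := sum2_squares_eqN1 'F_p.
exists x, y; rewrite (dvdn_pcharf (pchar_Fp p_pr)).
by rewrite !natrD !natrM !natr_Zp -!expr2 xy0.
Qed.

(** * Invertible numerals and fractions in a meadow *)

Section InversiveMeadow.
Variables (R : comPzRingType) (iv : R -> R).
Hypothesis ivK : involutive iv.
Hypothesis ril : forall x, x * (x * iv x) = x.

(** Multiplication by [a * iv a] fixes [a], hence every multiple of [a], and 1 is such a
    multiple. *)
Lemma iv_eq (a b : R) : a * b = 1 -> iv a = b.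
Proof.
move=> ab1; have aV : a * iv a = 1.
  by rewrite -[LHS]mulr1 -ab1 mulrA -[a * iv a * a]mulrC ril.
by rewrite -[LHS]mulr1 -ab1 mulrA [iv a * a]mulrC aV mul1r.
Qed.

Lemma iv0 : iv 0 = 0.
Proof. by rewrite -[LHS]ril ivK mulr0 mulr0. Qed.

Lemma mul_iv_factor (a b : R) : a * b * iv (a * b) = 1 -> a * iv a = 1.
Proof. by rewrite -mulrA => ab1; rewrite (iv_eq ab1). Qed.

Lemma mul_iv_mul (a b : R) :
  a * iv a = 1 -> b * iv b = 1 -> a * b * iv (a * b) = 1.
Proof.
move=> a1 b1; have ab1 : (a * b) * (iv a * iv b) = 1 by rewrite mulrACA a1 b1 mulr1.
by rewrite (iv_eq ab1).
Qed.

Hypothesis sq2 : forall x y, (1 + x * x + y * y) * iv (1 + x * x + y * y) = 1.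

Lemma natr_iv n : (0 < n)%N -> n%:R * iv n%:R = 1.
Proof.
elim/ltn_ind: n => -[//|[_ _|n IH _]]; first by rewrite (iv_eq (mulr1 1)) mulr1.
(* Split off the least prime factor; the cofactor is smaller than [m] and falls under the induction
   hypothesis. *)
set m := n.+2; have p_pr : prime (pdiv m) by apply: pdiv_prime.
rewrite -(divnK (pdiv_dvd m)) natrM; apply: mul_iv_mul.
  by apply: IH; rewrite ?ltn_Pdiv ?prime_gt1 // divn_gt0 ?pdiv_leq ?pdiv_gt0.
have [x [y /dvdnP[k xy]]] := prime_dvd_1_sum2_squares p_pr.
apply: (@mul_iv_factor _ k%:R); rewrite -natrM mulnC -xy !natrD !natrM; exact: sq2.
Qed.

Lemma intr_iv (d : int) : d != 0 -> d%:~R * iv d%:~R = 1.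
Proof.
case: d => [[|n]|n] // _; first exact: natr_iv.
(* A negative numeral is a factor of its opposite, a positive one. *)
rewrite NegzE mulrNz; apply: (@mul_iv_factor _ (- 1)); rewrite mulrN1 opprK.
exact: natr_iv.
Qed.

Definition rat_meadow (q : rat) : R := (numq q)%:~R * iv (denq q)%:~R.

(** Since [d] is invertible in [R], any fraction for [q], not only the reduced one, determines its
    image. The morphism laws can thus use unreduced common denominators. *)
Lemma rat_meadowP (q : rat) (n d : int) (z : R) :
  d != 0 -> q * d%:~R = n%:~R -> z * d%:~R = n%:~R -> rat_meadow q = z.
Proof.
move=> d0 qd zd.
have nd : numq q * d = n * denq q.
  by apply: (@intr_inj rat); rewrite !intrM numqE -qd mulrAC.
have dI : injective ( *%R^~ (d%:~R : R)).
  by apply: (can_inj (g := *%R^~ (iv d%:~R))) => w; rewrite -mulrA intr_iv ?mulr1.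
apply: dI; rewrite /= zd mulrAC -intrM nd intrM -mulrA.
by rewrite intr_iv ?denq_neq0 ?mulr1.
Qed.

Lemma rat_meadow_denq (q : rat) : rat_meadow q * (denq q)%:~R = (numq q)%:~R.
Proof. by rewrite -mulrA [iv _ * _]mulrC intr_iv ?denq_neq0 ?mulr1. Qed.

Lemma rat_meadow_int (n : int) : rat_meadow n%:~R = n%:~R.
Proof. by apply: (@rat_meadowP _ n 1); rewrite ?mulr1. Qed.

Lemma rat_meadowD : {morph rat_meadow : p q / p + q}.
Proof.
move=> p q; apply: (@rat_meadowP _ (numq p * denq q + numq q * denq p)
  (denq p * denq q)); first by rewrite mulf_neq0 ?denq_neq0.
  by rewrite intrD !intrM !numqE; ring.
by rewrite intrD !intrM -!rat_meadow_denq; ring.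
Qed.

Lemma rat_meadowM : {morph rat_meadow : p q / p * q}.
Proof.
move=> p q; apply: (@rat_meadowP _ (numq p * numq q)
  (denq p * denq q)); first by rewrite mulf_neq0 ?denq_neq0.
  by rewrite !intrM !numqE; ring.
by rewrite !intrM -!rat_meadow_denq; ring.
Qed.

Lemma rat_meadowN : {morph rat_meadow : q / - q}.
Proof.
by move=> q; rewrite -mulN1r rat_meadowM (rat_meadow_int (-1)) mulN1r.
Qed.

Lemma rat_meadowV : {morph rat_meadow : q / q^-1 >-> iv q}.
Proof.
move=> q; have [->|q0] := eqVneq q 0; first by rewrite invr0 (rat_meadow_int 0) iv0.
by symmetry; apply: iv_eq; rewrite -rat_meadowM mulfV // (rat_meadow_int 1).
Qed.

End InversiveMeadow.

(** * Models of the equations as rings *)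

(* Carries the ring structure of a model of the equations; the proof argument is
   what lets the instances below be found by unification. *)
Definition model (B : algebra) (BE : satisfies B meadow_sq2) : Type := B.

Section Model.
Variables (B : algebra) (BE : satisfies B meadow_sq2).

Let val3 (x y z : B) (i : nat) : B := nth x [:: x; y; z] i.

Let axiom l r (lr : inversive_meadow l r) (x y z : B) :
  eval (val3 x y z) l = eval (val3 x y z) r.
Proof. by apply: BE; left. Qed.

Let addA : associative (@add B).
Proof. by move=> x y z; symmetry; apply: (axiom imd_addA x y z). Qed.
Let addC : commutative (@add B).
Proof. by move=> x y; apply: (axiom imd_addC x y x). Qed.
Let add0 : left_id (zero B) (@add B).
Proof. by move=> x; rewrite addC; apply: (axiom imd_add0 x x x). Qed.
Let addN : left_inverse (zero B) (@opp B) (@add B).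
Proof. by move=> x; rewrite addC; apply: (axiom imd_addN x x x). Qed.
Let mulA : associative (@mul B).
Proof. by move=> x y z; symmetry; apply: (axiom imd_mulA x y z). Qed.
Let mulC : commutative (@mul B).
Proof. by move=> x y; apply: (axiom imd_mulC x y x). Qed.
Let mul1 : left_id (one B) (@mul B).
Proof. by move=> x; rewrite mulC; apply: (axiom imd_mul1 x x x). Qed.
Let mulD : left_distributive (@mul B) (@add B).
Proof.
by move=> x y z; rewrite mulC (axiom imd_mulD z x y : mul z _ = _) /= ![mul z _]mulC.
Qed.

HB.instance Definition _ := gen_eqMixin (model BE).
HB.instance Definition _ := gen_choiceMixin (model BE).
HB.instance Definition _ :=
  GRing.isZmodule.Build (model BE) addA addC add0 addN.
HB.instance Definition _ :=
  GRing.Zmodule_isComPzRing.Build (model BE) mulA mulC mul1 mulD.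

Lemma model_hom_rat : exists g : Q0 -> B, hom g.
Proof.
pose iv : model BE -> model BE := @inv B.
have ivK : involutive iv by move=> x; apply: (axiom imd_invK x x x).
have ril (x : model BE) : x * (x * iv x) = x by apply: (axiom imd_ril x x x).
have sq2 (x y : model BE) : (1 + x * x + y * y) * iv (1 + x * x + y * y) = 1.
  exact: (BE sq2_inv (val3 x y x)).
exists (rat_meadow iv); split.
- exact: (rat_meadow_int ril sq2 0).
- exact: (rat_meadow_int ril sq2 1).
- exact: (rat_meadowD ril sq2).
- exact: (rat_meadowM ril sq2).
- exact: (rat_meadowN ril sq2).
- exact: (rat_meadowV ivK ril sq2).
Qed.

End Model.

(** * The rationals as a model, and the isomorphism *)

Lemma Q0_satisfies : satisfies Q0 meadow_sq2.
Proof.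
move=> l r [{}l {}r [] v|v] /=.
- by rewrite addrA.
- exact: addrC.
- exact: addr0.
- exact: subrr.
- by rewrite mulrA.
- exact: mulrC.
- exact: mulr1.
- exact: mulrDr.
- exact: invrK.
- by have [->|v0] := eqVneq (v 0%N) 0; rewrite ?mul0r // divff ?mulr1.
(* Over the ordered field of rationals, 1 plus two squares is positive, hence nonzero. *)
- rewrite mulfV // gt_eqF // -!expr2 -addrA ltr_wpDr //.
  by rewrite addr_ge0 ?sqr_ge0.
Qed.

Lemma hom_comp (A B C : algebra) (f : A -> B) (g : B -> C) :
  hom f -> hom g -> hom (g \o f).
Proof. by move=> [? ? ? ? ? ?] [? ? ? ? ? ?]; split=> *; rewrite /=; congruence. Qed.

(** Naturals, then integers, then their quotients are values of closed terms, so [h] fixes them. *)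
Lemma hom_Q0_id (h : Q0 -> Q0) : hom h -> h =1 id.
Proof.
case=> h0 h1 hD hM hN hV.
have hnat (n : nat) : h n%:R = n%:R by elim: n => // n IH; rewrite -natr1 hD IH h1.
have hint (n : int) : h n%:~R = n%:~R.
  by case: n => n; rewrite ?NegzE ?mulrNz ?hN hnat.
by move=> q; rewrite -[q]divq_num_den hM hV !hint.
Qed.

Theorem theorem2 : isomorphic (Init meadow_sq2) Q0.
Proof.
have [IE init] := Init_initial meadow_sq2.
have [f [fh _]] := init _ Q0_satisfies; have [g gh] := model_hom_rat IE.
have [i [_ i_uniq]] := init _ IE.
exists f; split=> //; exists g => [x|q].
  (* Both [g \o f] and [id] are endomorphisms of the initial algebra, so uniqueness identifies
     them. *)
  rewrite -[LHS]/((g \o f) x) (i_uniq _ (hom_comp fh gh)) -(i_uniq id) //.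
exact: hom_Q0_id (hom_comp gh fh) q.
Qed.
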